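(* Let $n\ge2$, $1\le m\le n$, and let $X_1,\dots,X_n$ be random variables with one-dimensional cdf's $F_1,\dots,F_n$ whose joint cdf is absolutely continuous with respect to $\prod_{k=1}^nF_k(x_k)$. Let $\xi_1,\dots,\xi_n$ be independent random variables with cdf's $F_1,\dots,F_n$, and let $g_{i_1,\dots,i_c}$ be the canonical functions of the joint distribution of $X_1,\dots,X_n$, with the convention that $g_i\equiv0$ for a single index $i$. Then $X_1,\dots,X_n$ are $m$-dependent if and only if $$g_{i_1,\dots,i_k,i_{k+1},\dots,i_c}(\xi_{i_1},\dots,\xi_{i_k},\xi_{i_{k+1}},\dots,\xi_{i_c})=g_{i_1,\dots,i_k}(\xi_{i_1},\dots,\xi_{i_k})\,g_{i_{k+1},\dots,i_c}(\xi_{i_{k+1}},\dots,\xi_{i_c})\ \text{(a.s.)}$$ for all $1\le i_1<\dots<i_k<i_{k+1}<\dots<i_c\le n$ with $i_{k+1}-i_k\ge m$, $k=1,\dots,c-1$, $c=2,\dots,n$.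
   Context: Random variables $X_1,\dots,X_n$ are called $m$-dependent ($1\le m\le n$) if any two vectors $(X_{j_1},\dots,X_{j_a})$ and $(X_{j_{a+1}},\dots,X_{j_l})$, where $1\le j_1<\dots<j_a<j_{a+1}<\dots<j_l\le n$, $a=1,\dots,l-1$, $l=2,\dots,n$, $j_{a+1}-j_a\ge m$, are independent. Canonical functions: if the joint cdf $F$ of $X_1,\dots,X_n$ is absolutely continuous with respect to the product of its marginals, i.e. $F(x_1,\dots,x_n)=\int_{-\infty}^{x_1}\cdots\int_{-\infty}^{x_n}G\,dF_1\cdots dF_n$ for some Borel $G\ge0$, then there exist Borel functions $g_{i_1,\dots,i_c}:\mathbf R^c\to\mathbf R$, $1\le i_1<\dots<i_c\le n$, $c=2,\dots,n$, with: (A1) $E|g_{i_1,\dots,i_c}(\xi_{i_1},\dots,\xi_{i_c})|<\infty$; (A2) $E(g_{i_1,\dots,i_c}(\xi_{i_1},\dots,\xi_{i_c})\mid\xi_{i_1},\dots,\xi_{i_{k-1}},\xi_{i_{k+1}},\dots,\xi_{i_c})=0$ (a.s.) for $k=1,\dots,c$; (A3) $U_n(\xi_1,\dots,\xi_n):=\sum_{c=2}^n\sum_{1\le i_1<\dots<i_c\le n}g_{i_1,\dots,i_c}(\xi_{i_1},\dots,\xi_{i_c})\ge-1$ (a.s.); and $$F(x_1,\dots,x_n)=\int_{-\infty}^{x_1}\cdots\int_{-\infty}^{x_n}(1+U_n(t_1,\dots,t_n))\prod_{i=1}^ndF_i(t_i).$$ The random variables $g_{i_1,\dots,i_c}(\xi_{i_1},\dots,\xi_{i_c})$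 are a.s. uniquely determined by $F$. These $g_{i_1,\dots,i_c}$ are called here the canonical functions of the joint distribution. *)

(* Defs.v *)
From HB Require Import structures.
From mathcomp Require Import all_boot all_order all_algebra.
From mathcomp Require Import all_classical all_reals all_analysis.

Set Implicit Arguments.
Unset Strict Implicit.
Unset Printing Implicit Defensive.

Import Order.TTheory GRing.Theory Num.Theory.
Local Open Scope classical_set_scope.
Local Open Scope ring_scope.

(* Points of R^n are n-tuples, with the (Borel) product sigma-algebra that
   mathcomp-analysis puts on [n.-tuple R].  A strictly increasing sequence
   i_1 < ... < i_c of indices is encoded by the set A = {i_1, ..., i_c}:
   [enum_val] lists the elements of A in increasing order, so that [subvec A x]
   is the vector (x_{i_1}, ..., x_{i_c}). *)
Definition subvec (T : Type) (n : nat) (A : {set 'I_n}) (x : n.-tuple T) :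
    #|A|.-tuple T :=
  [tuple tnth x (enum_val k) | k < #|A|].

(* For nonempty A and B and m >= 1: max A < min B and min B - max A >= m. *)
Definition gap_at_least (n m : nat) (A B : {set 'I_n}) : Prop :=
  forall i j : 'I_n, i \in A -> j \in B -> (i + m <= j)%N.

Section random_vectors.
Context (d : measure_display) (T : measurableType d) (R : realType)
  (P : probability T R).

Definition random_vector (n : nat) (X : 'I_n -> {RV P >-> R}) (w : T) :
    n.-tuple R :=
  [tuple X i w | i < n].

Definition joint_cdf (n : nat) (X : 'I_n -> {RV P >-> R}) (x : n.-tuple R) :
    \bar R :=
  P [set w | forall i : 'I_n, X i w <= tnth x i].

Definition independent_pair (d1 d2 : measure_display)
    (T1 : measurableType d1) (T2 : measurableType d2)
    (V : T -> T1) (W : T -> T2) : Prop :=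
  forall (E1 : set T1) (E2 : set T2), measurable E1 -> measurable E2 ->
    (P (V @^-1` E1 `&` W @^-1` E2) = P (V @^-1` E1) * P (W @^-1` E2))%E.

Definition mutually_independent (n : nat) (X : 'I_n -> {RV P >-> R}) : Prop :=
  forall (J : {set 'I_n}) (E : 'I_n -> set R),
    (forall i, measurable (E i)) ->
    (P [set w | forall i, i \in J -> E i (X i w)] =
     \prod_(i in J) P (X i @^-1` E i))%E.

Definition m_dependent (n m : nat) (X : 'I_n -> {RV P >-> R}) : Prop :=
  forall A B : {set 'I_n}, A != finset.set0 -> B != finset.set0 ->
    gap_at_least m A B ->
    independent_pair (fun w => subvec A (random_vector X w))
                     (fun w => subvec B (random_vector X w)).

(* Z is a version of the conditional expectation E(Y | V). *)
Definition is_cond_expectation (d' : measure_display) (T' : measurableType d')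
    (Y : T -> R) (V : T -> T') (Z : T -> R) : Prop :=
  [/\ (forall B : set R, measurable B ->
         g_sigma_algebra_preimage V (Z @^-1` B)),
      P.-integrable [set: T] (EFin \o Z) &
      forall C : set T, g_sigma_algebra_preimage V C ->
        (\int[P]_(w in C) (Z w)%:E = \int[P]_(w in C) (Y w)%:E)%E].

End random_vectors.

(* The iterated integral
     int_{-oo}^{x_1} ... int_{-oo}^{x_n} G(t_1, ..., t_n) dmu_n ... dmu_1. *)
Fixpoint iterated_integral (R : realType) (n : nat) :
    ('I_n -> probability R R) -> n.-tuple R ->
    (n.-tuple R -> \bar R) -> \bar R :=
  match n with
  | 0 => fun _ _ G => G [tuple]
  | n'.+1 => fun mu x G =>
      (\int[mu ord0]_(t in `]-oo, thead x]%classic)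
         iterated_integral (fun i => mu (lift ord0 i)) [tuple of behead x]
           (fun s => G [tuple of t :: s]))%E
  end.

Section joint_distribution.
Context (d : measure_display) (T : measurableType d) (R : realType)
  (P : probability T R) (n : nat) (X : 'I_n -> {RV P >-> R}).

(* The law of X_i is the Lebesgue-Stieltjes measure dF_i of its cdf F_i, see
   [lebesgue_stieltjes_cdf_id] in mathcomp-analysis. *)
Definition marginal (i : 'I_n) : probability R R :=
  distribution P (X i).

Definition joint_cdf_abs_continuous : Prop :=
  exists G : n.-tuple R -> R,
    [/\ measurable_fun [set: n.-tuple R] G,
        (forall t, 0 <= G t) &
        forall x, joint_cdf X x = iterated_integral marginal x (EFin \o G)].

(* g A, for A = {i_1 < ... < i_c}, stands for g_{i_1,...,i_c} : R^c -> R; only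
   the values at sets with at least two elements are relevant. *)
Definition U_stat (g : forall A : {set 'I_n}, #|A|.-tuple R -> R)
    (x : n.-tuple R) : R :=
  \sum_(A : {set 'I_n} | (2 <= #|A|)%N) g A (subvec A x).

Context (d' : measure_display) (T' : measurableType d') (P' : probability T' R)
  (xi : 'I_n -> {RV P' >-> R}).

Record canonical_functions (g : forall A : {set 'I_n}, #|A|.-tuple R -> R) :
    Prop := CanonicalFunctions {
  canonical_borel : forall A : {set 'I_n}, (2 <= #|A|)%N ->
    measurable_fun [set: #|A|.-tuple R] (g A) ;
  canonical_A1 : forall A : {set 'I_n}, (2 <= #|A|)%N ->
    ('E_P'[fun w => `|g A (subvec A (random_vector xi w))|%R] < +oo)%E ;
  canonical_A2 : forall A : {set 'I_n}, (2 <= #|A|)%N ->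
    forall i : 'I_n, i \in A ->
    is_cond_expectation P' (fun w => g A (subvec A (random_vector xi w)))
      (fun w => subvec (A :\ i)%SET (random_vector xi w)) (fun=> 0) ;
  canonical_A3 : {ae P', forall w, -1 <= U_stat g (random_vector xi w)} ;
  canonical_repr : forall x : n.-tuple R,
    joint_cdf X x =
    iterated_integral marginal x (fun t => (1 + U_stat g t)%:E)
}.

End joint_distribution.

(* The family g with the convention that g_i is 0 for a single index i. *)
Definition zero_on_singletons (R : realType) (n : nat)
    (g : forall A : {set 'I_n}, #|A|.-tuple R -> R) (A : {set 'I_n}) :
    #|A|.-tuple R -> R :=
  if #|A| == 1%N then fun=> 0 else g A.

(* Main.v *)
Require Import Defs.
From HB Require Import structures.
From mathcomp Require Import all_boot all_order all_algebra.
From mathcomp Require Import all_classical all_reals all_analysis.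
From mathcomp Require Import measurable_realfun.

(* Put h_0 = 1, h_A = 0 for singletons and h_A = g_A otherwise, viewed on R^n
   with the law nu of xi. By (A2) and independence, h_A integrates to 0 on every
   cylinder over S unless A is contained in S; hence the law of (X_i)_{i in S} has
   density f_S = sum_{A subset S} h_A with respect to the law of (xi_i)_{i in S}.
   If every block h_{C u D} with C in A and D in B factors, then f_{A u B} =
   f_A f_B, which is independence of the two subvectors. Conversely,
   independence gives f_{A u B} = f_A f_B almost surely by uniqueness of
   densities; expanding both sides over pairs (C, D) with C in A and D in B, all
   terms but (A, B) cancel by induction. *)

Set Implicit Arguments.
Unset Strict Implicit.
Unset Printing Implicit Defensive.

Import Order.TTheory GRing.Theory Num.Theory.
Local Open Scope classical_set_scope.
Local Open Scope ring_scope.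

(** The hypotheses do not come in the form that the argument uses. The representation of the joint
    law is an iterated integral known on orthants only, and (A2) speaks of conditional expectations;
    both become integrals over boxes against the single measure nu. The terms h_A have no sign, so
    Fubini and the uniqueness arguments are carried out for integrable functions instead of
    measures. Subvectors of different lengths have different types; functions of them are kept on
    R^n, insensitive to the other coordinates, so that they can be multiplied and compared. The gap
    condition acts in two ways: for m >= 1 it makes the blocks disjoint, and it is inherited by
    subsets, which supplies all the smaller pairs (C, D). The value 0 on singletons is forced: for S
    = {i}, f_S is 1 + h_S, and it must be 1 because X_i and xi_i have the same law. *)

(* The two sides are set functions of [E] that may be signed, which is why
   uniqueness of measures does not apply directly. *)
Lemma eq_integral_preimage (R : realType) (d d1 d2 : measure_display)
    (T : measurableType d) (T1 : measurableType d1) (T2 : measurableType d2)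
    (m1 : {measure set T1 -> \bar R}) (m2 : {measure set T2 -> \bar R})
    (V1 : T1 -> T) (V2 : T2 -> T) (f1 : T1 -> \bar R) (f2 : T2 -> \bar R)
    (G : set (set T)) :
  measurable_fun [set: T1] V1 -> measurable_fun [set: T2] V2 ->
  m1.-integrable [set: T1] f1 -> m2.-integrable [set: T2] f2 ->
  setI_closed G -> @measurable _ T = <<s G >> ->
  (\int[m1]_x f1 x = \int[m2]_x f2 x)%E ->
  (forall E, G E ->
    \int[m1]_(x in V1 @^-1` E) f1 x = \int[m2]_(x in V2 @^-1` E) f2 x)%E ->
  forall E, measurable E ->
    (\int[m1]_(x in V1 @^-1` E) f1 x = \int[m2]_(x in V2 @^-1` E) f2 x)%E.
Proof.
move=> mV1 mV2 if1 if2 GI GE fT fG.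
have mp1 E : measurable E -> measurable (V1 @^-1` E).
  by move=> mE; rewrite -[X in measurable X]setTI; exact: mV1.
have mp2 E : measurable E -> measurable (V2 @^-1` E).
  by move=> mE; rewrite -[X in measurable X]setTI; exact: mV2.
(* Closure under complements is a subtraction of finite integrals. It needs the value on the whole
   space, which [G] may fail to contain; hence the separate hypothesis on total integrals. *)
have intC d' (T' : measurableType d') (m : {measure set T' -> \bar R}) f
    (A : set T') : measurable A -> m.-integrable [set: T'] f ->
    (\int[m]_(x in ~` A) f x = \int[m]_x f x - \int[m]_(x in A) f x)%E.
  move=> mA fi; rewrite -[in X in _ = (X - _)%E](setUv A) integral_setU //.
  - rewrite addeAC subee ?add0e //.
    by apply: integrable_fin_num => //; exact: integrableS fi.
  - exact: measurableC.
  - by rewrite setUv; exact: measurable_int fi.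
  - by apply/disj_setPS; rewrite setICr.
move=> E mE; move: (mE); rewrite GE.
apply: (@dynkin_induction _ _ G (fun E => \int[m1]_(x in V1 @^-1` E) f1 x =
   \int[m2]_(x in V2 @^-1` E) f2 x)%E) => //.
- move=> S mS eqS.
  rewrite -(preimage_setC V1 S) -(preimage_setC V2 S).
  rewrite (intC _ _ m1 f1 _ (mp1 _ mS) if1).
  by rewrite (intC _ _ m2 f2 _ (mp2 _ mS) if2) fT eqS.
- move=> F mF tF eqF; rewrite !preimage_bigcup !integral_bigcup //.
  + by apply: eq_eseriesr => i _; exact: eqF.
  + by apply/trivIsetP => i j _ _ ij;
      rewrite -preimage_setI (trivIsetP.1 tF i j) ?preimage_set0.
  + by move=> k; exact: mp2.
  + apply: integrableS if2 => //; apply: bigcup_measurable => k _; exact: mp2.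
  + by apply/trivIsetP => i j _ _ ij;
      rewrite -preimage_setI (trivIsetP.1 tF i j) ?preimage_set0.
  + by move=> k; exact: mp1.
  + apply: integrableS if1 => //; apply: bigcup_measurable => k _; exact: mp1.
Qed.

(** * Boxes and orthants as generating classes *)

Definition box (R : realType) (n : nat) (A : {set 'I_n}) (E : 'I_n -> set R) :
    set (n.-tuple R) :=
  [set x | forall i, i \in A -> E i (tnth x i)].

Definition boxes (R : realType) (n : nat) : set (set (n.-tuple R)) :=
  [set B | exists2 E : 'I_n -> set R, (forall i, measurable (E i)) &
     B = box [set: 'I_n]%SET E].

Definition orthant (R : realType) (n : nat) (x : n.-tuple R) :
    set (n.-tuple R) :=
  [set y | forall i, tnth y i <= tnth x i].

Definition orthants (R : realType) (n : nat) : set (set (n.-tuple R)) :=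
  [set B | exists x, B = orthant x].

Lemma measurable_box (R : realType) (n : nat) (A : {set 'I_n})
    (E : 'I_n -> set R) :
  (forall i, measurable (E i)) -> measurable (box A E).
Proof.
move=> mE; have -> : box A E =
    \bigcap_(i in [set` A]) ((fun y : n.-tuple R => tnth y i) @^-1` E i).
  by apply/seteqP; split.
apply: fin_bigcap_measurable => [|i _]; first exact: finite_finset.
by rewrite -[X in measurable X]setTI; exact: measurable_tnth.
Qed.

Lemma orthant_box (R : realType) (n : nat) (x : n.-tuple R) :
  orthant x = box [set: 'I_n]%SET (fun i => `]-oo, tnth x i]%classic).
Proof.
apply/seteqP; split => y h i; first by move=> _; rewrite /= in_itv /= h.
by have := h i (finset.in_setT _); rewrite /= in_itv.
Qed.

Lemma measurable_orthant (R : realType) (n : nat) (x : n.-tuple R) :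
  measurable (orthant x).
Proof. by rewrite orthant_box; apply: measurable_box => i. Qed.

Lemma boxI (R : realType) (n : nat) (A : {set 'I_n}) (E F : 'I_n -> set R) :
  box A E `&` box A F = box A (fun i => E i `&` F i).
Proof.
apply/seteqP; split => x /=; first by move=> [hE hF] i iA; split; auto.
by move=> h; split => i iA; case: (h i iA).
Qed.

Lemma boxU (R : realType) (n : nat) (A B : {set 'I_n}) (E : 'I_n -> set R) :
  box (A :|: B) E = box A E `&` box B E.
Proof.
apply/seteqP; split => x /=.
  by move=> h; split => i iA; apply: h; rewrite finset.in_setU iA ?orbT.
by move=> [hA hB] i; rewrite finset.in_setU => /orP[]; auto.
Qed.

Lemma box0 (R : realType) (n : nat) (E : 'I_n -> set R) :
  box finset.set0 E = [set: n.-tuple R].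
Proof. by apply/seteqP; split => x //= _ i; rewrite finset.in_set0. Qed.

Lemma boxes_setI (R : realType) (n : nat) : setI_closed (@boxes R n).
Proof.
move=> _ _ [E mE ->] [F mF ->]; exists (fun i => E i `&` F i).
  by move=> i; exact: measurableI.
exact: boxI.
Qed.

Lemma orthants_setI (R : realType) (n : nat) : setI_closed (@orthants R n).
Proof.
move=> _ _ [x ->] [y ->].
exists [tuple Num.min (tnth x i) (tnth y i) | i < n].
apply/seteqP; split => z /=.
  by move=> [hx hy] i; rewrite tnth_mktuple le_min hx hy.
by move=> h; split => i; have := h i; rewrite tnth_mktuple le_min => /andP[].
Qed.

(** Complements of closed left rays are open right rays, which are known to generate. *)
Lemma measurable_itvNyc_gen (R : realType) :
  @measurable _ R = <<s [set B : set R | exists a, B = `]-oo, a]%classic] >>.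
Proof.
apply/seteqP; split; last first.
  apply: smallest_sub; first exact: sigma_algebra_measurable.
  by move=> _ [a ->].
have -> : @measurable _ R = <<s @RGenOInfty.G R >>.
  exact: RGenOInfty.measurableE.
apply: smallest_sub; first exact: smallest_sigma_algebra.
move=> _ [a ->]; rewrite -setCitvl.
rewrite -setTD; case: (@smallest_sigma_algebra R [set: R]
  [set B : set R | exists a, B = `]-oo, a]%classic]) => _ gC _.
by apply: gC; apply: sub_sigma_algebra; exists a.
Qed.

(** A half-space bounding a single coordinate i by a is the countable union of the orthants whose
    corner is a in position i and k elsewhere. *)
Lemma measurable_orthants_gen (R : realType) (n : nat) :
  @measurable _ (n.-tuple R) = <<s @orthants R n >>.
Proof.
apply/seteqP; split; last first.
  apply: smallest_sub; first exact: sigma_algebra_measurable.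
  by move=> _ [a ->]; exact: measurable_orthant.
apply: smallest_sub; first exact: smallest_sigma_algebra.
move=> B; rewrite -bigcup_seq => -[i _ [C mC <-]]; rewrite setTI.
move: C mC; rewrite measurable_itvNyc_gen.
pose p (y : n.-tuple R) := tnth y i.
apply: (@smallest_sub _ _ _ [set C : set R | <<s @orthants R n >> (p @^-1` C)]).
  split=> /=.
  - by rewrite preimage_set0; exact: sigma_algebra0.
  - move=> C hC; rewrite setTD -preimage_setC -setTD.
    case: (@smallest_sigma_algebra _ [set: n.-tuple R] (@orthants R n)).
    by move=> _ + _; exact.
  - move=> F hF; rewrite preimage_bigcup; exact: sigma_algebra_bigcup.
move=> _ [a ->] /=.
have -> : p @^-1` `]-oo, a]%classic =
    \bigcup_k orthant [tuple if j == i then a else k%:R | j < n].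
  apply/seteqP; split => y /=.
    rewrite in_itv /= => ya.
    (* Any k above all the absolute values of the coordinates of [y] works. *)
    exists (\max_(j < n) (Num.truncn `|tnth y j|).+1)%N => // j.
    rewrite tnth_mktuple; case: eqP => [->//|_].
    apply: le_trans (ler_norm _) _; apply: ltW.
    apply: lt_le_trans (truncnS_gt _) _.
    by rewrite ler_nat (leq_bigmax_cond j).
  by move=> [k _ /(_ i)]; rewrite tnth_mktuple eqxx in_itv.
apply: sigma_algebra_bigcup => k; apply: sub_sigma_algebra.
by exists [tuple if j == i then a else k%:R | j < n].
Qed.

Lemma measurable_boxes_gen (R : realType) (n : nat) :
  @measurable _ (n.-tuple R) = <<s @boxes R n >>.
Proof.
apply/seteqP; split; last first.
  apply: smallest_sub; first exact: sigma_algebra_measurable.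
  by move=> _ [E mE ->]; exact: measurable_box.
rewrite measurable_orthants_gen; apply: smallest_sub.
  exact: smallest_sigma_algebra.
move=> _ [x ->]; suff : boxes (orthant x) by exact: sub_sigma_algebra.
by exists (fun i => `]-oo, tnth x i]%classic) => //; exact: orthant_box.
Qed.

(** * Independence and product measures *)

(** The generating classes are enlarged one at a time: [step] keeps one event fixed and extends the
    other, and is then applied with the roles of [V] and [W] exchanged. *)
Lemma independent_pair_gen (R : realType) (d d1 d2 : measure_display)
    (T : measurableType d) (T1 : measurableType d1) (T2 : measurableType d2)
    (P : probability T R) (V : T -> T1) (W : T -> T2)
    (G1 : set (set T1)) (G2 : set (set T2)) :
  measurable_fun [set: T] V -> measurable_fun [set: T] W ->
  setI_closed G1 -> @measurable _ T1 = <<s G1 >> ->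
  setI_closed G2 -> @measurable _ T2 = <<s G2 >> ->
  (forall E1 E2, G1 E1 -> G2 E2 ->
    P (V @^-1` E1 `&` W @^-1` E2) = P (V @^-1` E1) * P (W @^-1` E2))%E ->
  independent_pair P V W.
Proof.
move=> mV mW G1I G1E G2I G2E VW.
have mpV E : measurable E -> measurable (V @^-1` E).
  by move=> mE; rewrite -[X in measurable X]setTI; exact: mV.
have mpW E : measurable E -> measurable (W @^-1` E).
  by move=> mE; rewrite -[X in measurable X]setTI; exact: mW.
have step d' d'' (S1 : measurableType d') (S2 : measurableType d'')
    (Z : T -> S1) (Y : T -> S2) (G : set (set S1)) (B : set S2) :
    measurable_fun [set: T] Z -> measurable (Y @^-1` B) ->
    setI_closed G -> @measurable _ S1 = <<s G >> ->
    (forall E, G E ->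
      P (Z @^-1` E `&` Y @^-1` B) = P (Z @^-1` E) * P (Y @^-1` B))%E ->
    forall E, measurable E ->
      (P (Z @^-1` E `&` Y @^-1` B) = P (Z @^-1` E) * P (Y @^-1` B))%E.
  move=> mZ mB GI GE hG E mE.
  have mpZ F : measurable F -> measurable (Z @^-1` F).
    by move=> mF; rewrite -[X in measurable X]setTI; exact: mZ.
  (* Both sides are written as integrals over the preimage of [F], of a constant and of an
     indicator, so that [eq_integral_preimage] applies. *)
  have cstE F : measurable F ->
      (\int[P]_(x in Z @^-1` F) (fine (P (Y @^-1` B)))%:E =
       P (Z @^-1` F) * P (Y @^-1` B))%E.
    move=> mF; rewrite integral_cst; last exact: mpZ.
    by rewrite fineK ?fin_num_measure// muleC.
  have indE F : measurable F ->
      (\int[P]_(x in Z @^-1` F) (\1_(Y @^-1` B) x)%:E =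
       P (Z @^-1` F `&` Y @^-1` B))%E.
    by move=> mF; rewrite integral_indic 1?setIC//; exact: mpZ.
  have mGE F : G F -> measurable F.
    by move=> GF; rewrite GE; exact: sub_sigma_algebra.
  rewrite -indE// -cstE//.
  apply: (@eq_integral_preimage _ _ _ _ _ _ _ _ _ _ _ _ _ G) => //.
  - exact: integrable_indic.
  - exact: finite_measure_integrable_cst.
  - have := indE _ measurableT; have := cstE _ measurableT.
    by rewrite !preimage_setT => -> ->; rewrite setTI probability_setT mul1e.
  - by move=> F GF; rewrite indE ?cstE ?hG//; exact: mGE.
move=> E1 E2 mE1 mE2; apply: (step _ _ _ _ V W G1) => //; first exact: mpW.
move=> F1 GF1; rewrite setIC muleC; apply: (step _ _ _ _ W V G2) => //.
  by apply: mpV; rewrite G1E; exact: sub_sigma_algebra.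
by move=> F2 GF2; rewrite setIC muleC VW.
Qed.

Definition pair_rv (R : realType) (d d1 d2 : measure_display)
    (T : measurableType d) (T1 : measurableType d1) (T2 : measurableType d2)
    (P : probability T R) (V : {RV P >-> T1}) (W : {RV P >-> T2}) :
    {RV P >-> (T1 * T2)%type} :=
  mfun_Sub (mem_set
    (measurable_fun_pair (measurable_funPT V) (measurable_funPT W))).

Lemma independent_pair_distribution (R : realType) (d d1 d2 : measure_display)
    (T : measurableType d) (T1 : measurableType d1) (T2 : measurableType d2)
    (P : probability T R) (V : {RV P >-> T1}) (W : {RV P >-> T2}) :
  independent_pair P V W -> forall A, measurable A ->
  (distribution P V \x distribution P W)%E A = distribution P (pair_rv V W) A.
Proof.
by move=> VW A; apply: product_measure_unique => B C mB mC; exact: VW.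
Qed.

Lemma integral_pair_independent (R : realType) (d d1 d2 : measure_display)
    (T : measurableType d) (T1 : measurableType d1) (T2 : measurableType d2)
    (P : probability T R) (V : {RV P >-> T1}) (W : {RV P >-> T2})
    (f : T1 * T2 -> \bar R) :
  independent_pair P V W -> measurable_fun setT f ->
  P.-integrable [set: T] (fun w => f (V w, W w)) ->
  (distribution P V \x distribution P W)%E.-integrable [set: T1 * T2] f /\
  (\int[P]_w f (V w, W w) =
   \int[distribution P V \x distribution P W]_z f z)%E.
Proof.
move=> VW mf fi.
have fi' : (distribution P (pair_rv V W)).-integrable [set: T1 * T2] f.
  by apply: integrable_pushforward.
split.
  case/integrableP: fi' => _ fi'; apply/integrableP; split => //.
  rewrite (eq_measure_integral (distribution P (pair_rv V W))) //.
  by move=> A mA _; exact: (independent_pair_distribution VW).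
rewrite (eq_measure_integral (distribution P (pair_rv V W))) => [|A mA _];
  last exact: (independent_pair_distribution VW).
by rewrite integral_pushforward.
Qed.

(** Integrability of the product is part of the conclusion: under the product of the two laws,
    Tonelli bounds it by the product of the two absolute integrals. *)
Lemma integralM_independent (R : realType) (d d1 d2 : measure_display)
    (T : measurableType d) (T1 : measurableType d1) (T2 : measurableType d2)
    (P : probability T R) (V : {RV P >-> T1}) (W : {RV P >-> T2})
    (f : T1 -> R) (g : T2 -> R) :
  independent_pair P V W -> measurable_fun [set: T1] f ->
  measurable_fun [set: T2] g ->
  P.-integrable [set: T] (fun w => (f (V w))%:E) ->
  P.-integrable [set: T] (fun w => (g (W w))%:E) ->
  P.-integrable [set: T] (fun w => (f (V w) * g (W w))%:E) /\
  (\int[P]_w (f (V w) * g (W w))%:E =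
   \int[P]_w (f (V w))%:E * \int[P]_w (g (W w))%:E)%E.
Proof.
move=> VW mf mg fi gi.
pose h (z : T1 * T2) := (f z.1 * g z.2)%:E.
have mh : measurable_fun setT h.
  by apply/measurable_EFinP; apply: measurable_funM; exact: measurableT_comp.
have fi' : (distribution P V).-integrable [set: T1] (fun x => (f x)%:E).
  by apply: integrable_pushforward => //; exact/measurable_EFinP.
have gi' : (distribution P W).-integrable [set: T2] (fun x => (g x)%:E).
  by apply: integrable_pushforward => //; exact/measurable_EFinP.
have hi : (distribution P V \x distribution P W)%E.-integrable [set: T1 * T2] h.
  apply/integrable12ltyP => //.
  have gE x : (\int[distribution P W]_y `|h (x, y)| =
      `|f x|%:E * \int[distribution P W]_y `|(g y)%:E|)%E.
    rewrite -ge0_integralZl_EFin//.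
    - by apply: eq_integral => y _; rewrite /h /= normrM EFinM.
    - by do 2 apply: measurableT_comp => //.
  under eq_integral do rewrite gE muleC.
  have [_ gfin] := integrableP _ _ _ gi'.
  have [_ ffin] := integrableP _ _ _ fi'.
  rewrite ge0_integralZl//.
  - rewrite lte_mul_pinfty// ?integral_ge0//.
    by rewrite ge0_fin_numE ?integral_ge0.
  - by do 2 apply: measurableT_comp => //.
  - exact: integral_ge0.
have hi' : P.-integrable [set: T] (fun w => (f (V w) * g (W w))%:E).
  apply/integrableP; split.
    by apply: (@measurableT_comp _ _ _ _ _ _ h _ (pair_rv V W)).
  case/integrableP: hi => _.
  rewrite (eq_measure_integral (distribution P (pair_rv V W))) => [|A mA _];
    last exact: (independent_pair_distribution VW).
  by rewrite ge0_integral_pushforward//; apply: measurableT_comp.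
split => //.
have [_ ->] := @integral_pair_independent _ _ _ _ _ _ _ _ V W h VW mh hi'.
rewrite -integral12_prod_meas1//.
transitivity
  (\int[distribution P V]_x ((f x)%:E * \int[distribution P W]_y (g y)%:E))%E.
  apply: eq_integral => x _; rewrite /fubini_F -integralZl//.
have fing : (\int[distribution P W]_y (g y)%:E)%E \is a fin_num.
  exact: integrable_fin_num.
rewrite -(fineK fing) integralZr// fineK//.
by rewrite !integral_pushforward//; apply/measurable_EFinP.
Qed.

(** * Iterated integrals as integrals over orthants *)

(** Tonelli's measurability statement is for nonnegative functions on the whole space; so [f] is
    extended by 0 outside [D] and split into its positive and negative parts. *)
Lemma measurable_fun_integral_snd (R : realType) (d1 d2 : measure_display)
    (T1 : measurableType d1) (T2 : measurableType d2)
    (mu : {sigma_finite_measure set T2 -> \bar R}) (D : set T2)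
    (f : T1 * T2 -> \bar R) :
  measurable D -> measurable_fun setT f ->
  measurable_fun setT (fun x => \int[mu]_(y in D) f (x, y))%E.
Proof.
move=> mD mf.
pose h := f \_ ([set: T1] `*` D).
have mh : measurable_fun setT h.
  apply/(measurable_restrictT _ _).1 => //; first exact: measurableX.
  exact: measurable_funTS.
have -> : (fun x => \int[mu]_(y in D) f (x, y))%E =
    (fun x => \int[mu]_y h^\+ (x, y) - \int[mu]_y h^\- (x, y))%E.
  apply/funext => x; rewrite integral_mkcond [LHS]integralE.
  have hE : (fun y => f (x, y)) \_ D = fun y => h (x, y).
    by apply/funext => y; rewrite /h /patch in_setX in_setT.
  rewrite hE (_ : (fun y => h (x, y)) = h \o pair x)//.
  by rewrite funepos_comp funeneg_comp.
apply: (@emeasurable_funB _ _ _ _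
  (fun x => \int[mu]_y h^\+ (x, y))%E (fun x => \int[mu]_y h^\- (x, y))%E).
  apply: (@measurable_fun_fubini_tonelli_F _ _ _ _ _ mu h^\+%E) => //.
  exact: measurable_funepos.
apply: (@measurable_fun_fubini_tonelli_F _ _ _ _ _ mu h^\-%E) => //.
exact: measurable_funeneg.
Qed.

(** The parameter space [T] is arbitrary so that the induction can move the outermost variable of
    integration into it. *)
Lemma measurable_iterated_integral (R : realType) (n : nat)
    (mu : 'I_n -> probability R R) (x : n.-tuple R) (d : measure_display)
    (T : measurableType d) (G : T * n.-tuple R -> \bar R) :
  measurable_fun setT G ->
  measurable_fun setT (fun s => iterated_integral mu x (fun y => G (s, y))).
Proof.
elim: n mu x d T G => [|n IH] mu x d T G mG /=.
  by apply: measurableT_comp mG _; exact: measurable_fun_pair.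
pose G' (z : (T * R) * n.-tuple R) := G (z.1.1, [tuple of z.1.2 :: z.2]).
have mG' : measurable_fun setT G'.
  apply: measurableT_comp mG _; apply: measurable_fun_pair.
    by apply: measurableT_comp.
  by apply: measurable_cons => //; apply: measurableT_comp.
have := IH (fun i => mu (lift ord0 i)) [tuple of behead x] _ _ G' mG'.
move=> mI.
apply: (@measurable_fun_integral_snd _ _ _ _ _ (mu ord0) _
  (fun s : T * R => iterated_integral (fun i => mu (lift ord0 i))
    [tuple of behead x] (fun y => G' (s, y)))) => //.
Qed.

(** Since the measure of a box factors, head and tail are independent under [nu], and the tail
    satisfies the same hypothesis in dimension [n]. Fubini then peels off the outermost integral. *)
Lemma iterated_integralE (R : realType) (n : nat)
    (mu : 'I_n -> probability R R) (nu : probability (n.-tuple R) R) :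
  (forall E : 'I_n -> set R, (forall i, measurable (E i)) ->
    nu (box [set: 'I_n]%SET E) = \prod_i mu i (E i))%E ->
  forall (x : n.-tuple R) (G : n.-tuple R -> \bar R),
    nu.-integrable setT G ->
    iterated_integral mu x G = (\int[nu]_(y in orthant x) G y)%E.
Proof.
elim: n mu nu => [|n IH] mu nu nuE x G Gi /=.
  have -> : orthant x = setT by apply/seteqP; split => // y _ [].
  rewrite (eq_integral (cst (G [tuple]))) => [|y _]; last by rewrite tuple0.
  rewrite integral_cst// -[LHS]mule1; congr (_ * _)%E.
  exact/esym/probability_setT.
have mthead : measurable_fun setT (@thead n R) by exact: measurable_tnth.
pose hd : {RV nu >-> R} := mfun_Sub (mem_set mthead).
pose tl : {RV nu >-> n.-tuple R} :=
  mfun_Sub (mem_set (@measurable_behead _ R n)).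
have tlK (y : n.+1.-tuple R) j :
    tnth [tuple of behead y] j = tnth y (lift ord0 j).
  by rewrite [in RHS](tuple_eta y) tnthS.
have consE (y : n.+1.-tuple R) : [tuple of hd y :: tl y] = y.
  by rewrite [RHS]tuple_eta.
have hdtl A (E : 'I_n -> set R) :
    measurable A -> (forall i, measurable (E i)) ->
    (nu (hd @^-1` A `&` tl @^-1` box [set: 'I_n]%SET E) =
     mu ord0 A * \prod_i mu (lift ord0 i) (E i))%E.
  move=> mA mE.
  pose E' (i : 'I_n.+1) := if unlift ord0 i is Some j then E j else A.
  have -> : hd @^-1` A `&` tl @^-1` box [set: 'I_n]%SET E =
      box [set: 'I_n.+1]%SET E'.
    apply/seteqP; split => y /=.
      move=> [hA hE] i _; rewrite /E'; case: unliftP => [j ->|->//].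
      by have := hE j (finset.in_setT j); rewrite tlK.
    move=> h; split.
      by have := h ord0 (finset.in_setT _); rewrite /E' unlift_none.
    move=> j _; have := h (lift ord0 j) (finset.in_setT _).
    by rewrite /E' liftK -tlK.
  rewrite nuE; last by move=> i; rewrite /E'; case: unlift.
  rewrite big_ord_recl /E' unlift_none; congr (_ * _)%E.
  by apply: eq_bigr => i _; rewrite liftK.
have tlE (E : 'I_n -> set R) : (forall i, measurable (E i)) ->
    (distribution nu tl (box [set: 'I_n]%SET E) =
     \prod_i mu (lift ord0 i) (E i))%E.
  move=> mE; have := hdtl setT E measurableT mE.
  by rewrite preimage_setT setTI probability_setT mul1e.
have hdE A : measurable A -> distribution nu hd A = mu ord0 A.
  move=> mA; have := hdtl A (fun=> setT) mA (fun=> measurableT).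
  rewrite (_ : box _ _ = setT); last by apply/seteqP; split.
  rewrite preimage_setT setIT big1 ?mule1// => i _; exact: probability_setT.
have indep : independent_pair nu hd tl.
  apply: (@independent_pair_gen _ _ _ _ _ _ _ _ _ _
    measurable (@boxes R n)) => //.
  - exact: measurableI.
  - by rewrite sigma_algebra_id //; exact: sigma_algebra_measurable.
  - exact: boxes_setI.
  - exact: measurable_boxes_gen.
  - move=> A _ mA [E mE ->]; rewrite hdtl// -hdE// -tlE//.
pose I0 : set R := `]-oo, thead x]%classic.
pose O := orthant [tuple of behead x].
pose G1 (z : R * n.-tuple R) := G [tuple of z.1 :: z.2].
have mcons : measurable_fun setT
    (fun z : R * n.-tuple R => [tuple of z.1 :: z.2]).
  exact: measurable_cons.
have mG1 : measurable_fun setT G1.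
  by apply: measurableT_comp => //; exact: measurable_int Gi.
(* The orthant is a ray times the orthant of the tail; extension by 0 turns the bounded integrals
   into integrals over the whole product. *)
pose D := I0 `*` O.
have mI0 : measurable I0 by exact: measurable_itv.
have mD : measurable D by apply: measurableX => //; exact: measurable_orthant.
pose F := G1 \_ D.
have mF : measurable_fun setT F.
  by apply/(measurable_restrictT _ _).1 => //; exact: measurable_funTS.
have FE y : F (hd y, tl y) = (G \_ (orthant x)) y.
  rewrite /F /patch /G1 /= consE.
  suff -> : ((hd y, tl y) \in D) = (y \in orthant x) by [].
  apply/idP/idP; rewrite !inE => /=.
    move=> [h0 h] i; case: (unliftP ord0 i) => [j ->|->]; last first.
      by move: h0; rewrite /I0 /= in_itv.
    by have := h j; rewrite !tlK.
  move=> h; split => /=; first by rewrite /I0 /= in_itv /=; exact: h.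
  by move=> j; rewrite !tlK.
have Fi : nu.-integrable setT (fun y => F (hd y, tl y)).
  rewrite (_ : (fun _ => _) = G \_ (orthant x)); last exact/funext.
  apply/(integrable_mkcond _ _).1; first exact: measurable_orthant.
  by apply: integrableS Gi => //; exact: measurable_orthant.
have [Fprod Fint] := integral_pair_independent indep mF Fi.
transitivity (\int[distribution nu hd]_t fubini_F (distribution nu tl) F t)%E;
  last first.
  rewrite integral12_prod_meas1// -Fint [RHS]integral_mkcond.
  by apply: eq_integral => y _; exact: FE.
rewrite integral_mkcond.
rewrite (eq_measure_integral (distribution nu hd)); last first.
  by move=> A mA _; exact/esym/hdE.
(* The induction hypothesis asks for sections of [G] integrable on the whole space, so the
   unrestricted [G1] has to be integrable, not only [F]. *)
have G1i : (distribution nu hd \x distribution nu tl)%E.-integrable setT G1.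
  apply: (integral_pair_independent indep mG1 _).1.
  by rewrite (_ : (fun _ => _) = G) //; apply/funext => y; rewrite /G1 consE.
apply: ae_eq_integral => //.
- apply/(measurable_restrictT _ _).1 => //; apply: measurable_funTS.
  exact: (@measurable_iterated_integral _ _ _ _ _ _ G1 mG1).
- exact: measurable_int (integrable_fubini_F Fprod).
(* The inner sections of [G] are only almost everywhere integrable, and the
   induction hypothesis is used for those [t] alone. *)
have := ae_integrable1 G1i; apply: filterS => t /= Gti _.
rewrite /fubini_F /F /patch; case: ifPn => [tI|tI].
  rewrite (IH _ (distribution nu tl)) // [LHS]integral_mkcond.
  by apply: eq_integral => y _; rewrite /patch in_setX tI.
by apply/esym/integral0_eq => y _; rewrite in_setX (negbTE tI).
Qed.

(** * Functions of a subvector and independent coordinates *)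

(* Keeps the coordinates in [A] and sets the others to 0: a function of
   (x_i)_{i in A} is encoded as a function on R^n invariant under [restr A],
   so that functions of different subvectors live on the same space. *)
Definition restr (R : realType) (n : nat) (A : {set 'I_n}) (x : n.-tuple R) :
    n.-tuple R :=
  [tuple if i \in A then tnth x i else 0 | i < n].

Definition depends_on (R : realType) (n : nat) (A : {set 'I_n})
    (f : n.-tuple R -> R) : Prop :=
  forall x, f (restr A x) = f x.

Lemma measurable_restr (R : realType) (n : nat) (A : {set 'I_n}) :
  measurable_fun setT (@restr R n A).
Proof.
apply/measurable_fun_tnthP => i; rewrite (_ : _ \o _ =
    fun x => if i \in A then tnth x i else 0).
  by case: (i \in A); [exact: measurable_tnth|exact: measurable_cst].
by apply/funext => x; rewrite /= tnth_mktuple.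
Qed.

Lemma depends_onS (R : realType) (n : nat) (A B : {set 'I_n})
    (f : n.-tuple R -> R) :
  A \subset B -> depends_on A f -> depends_on B f.
Proof.
move=> AB fA x; rewrite -fA -[RHS]fA; congr f.
apply: eq_from_tnth => i; rewrite !tnth_mktuple.
by case: ifPn => // /(fintype.subsetP AB) ->.
Qed.

Lemma depends_onM (R : realType) (n : nat) (A : {set 'I_n})
    (f g : n.-tuple R -> R) :
  depends_on A f -> depends_on A g -> depends_on A (fun x => f x * g x).
Proof. by move=> fA gA x; rewrite fA gA. Qed.

Lemma depends_on_box (R : realType) (n : nat) (A : {set 'I_n})
    (E : 'I_n -> set R) :
  depends_on A (\1_(box A E) : n.-tuple R -> R).
Proof.
move=> x; rewrite !indicE; congr (_%:R); congr nat_of_bool.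
apply/idP/idP; rewrite !inE => h i iA; have := h i iA;
  by rewrite tnth_mktuple iA.
Qed.

(** Puts a box into the shape that the orthogonality relation handles, where only the coordinate [i]
    is left free by the index set. *)
Lemma box_setI_setD1 (R : realType) (n : nat) (A S : {set 'I_n}) (i : 'I_n)
    (E : 'I_n -> set R) :
  i \in A -> i \notin S ->
  box (A :&: S) E = box (A :\ i) (fun j => if j \in S then E j else setT).
Proof.
move=> iA iS; apply/seteqP; split => x h j.
  rewrite !finset.inE => /andP[_ jA]; case: ifPn => // jS.
  by apply: h; rewrite finset.inE jA.
rewrite finset.inE => /andP[jA jS]; have := h j.
rewrite !finset.inE jA jS; apply.
by rewrite andbT; apply: contraNneq iS => <-.
Qed.

Lemma box_setT (R : realType) (n : nat) (S : {set 'I_n}) (E : 'I_n -> set R) :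
  box S E = box [set: 'I_n]%SET (fun j => if j \in S then E j else setT).
Proof.
apply/seteqP; split => x h j jS; last first.
  by have := h j (finset.in_setT _); rewrite jS.
by case: ifPn => // ?; exact: h.
Qed.

Lemma integral_indic_mul (R : realType) (d : measure_display)
    (T : measurableType d) (mu : {measure set T -> \bar R}) (D : set T)
    (f : T -> R) :
  (\int[mu]_(x in D) (f x)%:E = \int[mu]_x (f x * \1_D x)%:E)%E.
Proof.
rewrite integral_mkcond; apply: eq_integral => x _.
by rewrite /patch indicE; case: ifPn; rewrite ?mulr1 ?mulr0.
Qed.

Lemma integrable_indic_mul (R : realType) (d : measure_display)
    (T : measurableType d) (mu : {measure set T -> \bar R}) (D : set T)
    (f : T -> R) :
  measurable D -> mu.-integrable setT (fun x => (f x)%:E) ->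
  mu.-integrable setT (fun x => (f x * \1_D x)%:E).
Proof.
move=> mD fi; rewrite (_ : (fun _ => _) = (fun x => (f x)%:E) \_ D); last first.
  apply/funext => x.
  by rewrite /patch indicE; case: ifPn; rewrite ?mulr1 ?mulr0.
by apply/(integrable_mkcond _ _).1 => //; apply: integrableS fi.
Qed.

(** One family [E] for both sets is enough when [A] and [B] are disjoint: two families can be
    glued. *)
Definition box_independent (R : realType) (n : nat)
    (mu : probability (n.-tuple R) R) (A B : {set 'I_n}) : Prop :=
  forall E : 'I_n -> set R, (forall i, measurable (E i)) ->
    (mu (box (A :|: B) E) = mu (box A E) * mu (box B E))%E.

Lemma box_independent2 (R : realType) (n : nat)
    (mu : probability (n.-tuple R) R) (A B : {set 'I_n})
    (E F : 'I_n -> set R) :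
  [disjoint A & B]%B -> box_independent mu A B ->
  (forall i, measurable (E i)) -> (forall i, measurable (F i)) ->
  (mu (box A E `&` box B F) = mu (box A E) * mu (box B F))%E.
Proof.
move=> AB muAB mE mF; pose H i := if i \in A then E i else F i.
have HA : box A E = box A H.
  by apply/seteqP; split => x h i iA; have := h i iA; rewrite /H iA.
have HB : box B F = box B H.
  apply/seteqP; split => x h i iB; have := h i iB;
  by rewrite /H (disjointFl AB iB).
by rewrite HA HB -boxU muAB // => i; rewrite /H; case: ifP.
Qed.

Lemma restr_independent (R : realType) (n : nat)
    (mu : probability (n.-tuple R) R) (A B : {set 'I_n}) :
  [disjoint A & B]%B -> box_independent mu A B ->
  independent_pair mu (@restr R n A) (restr B).
Proof.
move=> AB muAB.
(* Outside [C] the restricted vector is 0. A full box therefore pulls back to a box over [C] if its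
   other sides contain 0, and to the empty set otherwise. *)
have pre (C : {set 'I_n}) (E : 'I_n -> set R) :
    restr C @^-1` box [set: 'I_n]%SET E = box C E \/
    restr C @^-1` box [set: 'I_n]%SET E = set0.
  have [E0|nE0] := pselect (forall i, i \notin C -> E i 0).
    left; apply/seteqP; split => x h i iC.
      by have := h i (finset.in_setT _); rewrite tnth_mktuple iC.
    by rewrite tnth_mktuple; case: ifPn => [/h//|]; exact: E0.
  right; apply/seteqP; split => // x h; apply: nE0 => i iC.
  by have := h i (finset.in_setT _); rewrite tnth_mktuple (negbTE iC).
apply: (@independent_pair_gen _ _ _ _ _ _ _ _ _ _ (@boxes R n) (@boxes R n)).
- exact: measurable_restr.
- exact: measurable_restr.
- exact: boxes_setI.
- exact: measurable_boxes_gen.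
- exact: boxes_setI.
- exact: measurable_boxes_gen.
move=> _ _ [E mE ->] [F mF ->].
have [->|->] := pre A E; last by rewrite set0I measure0 mul0e.
have [->|->] := pre B F; last by rewrite setI0 measure0 mule0.
exact: box_independent2.
Qed.

Section independent_coordinates.
Context (R : realType) (n : nat) (nu : probability (n.-tuple R) R).
Context (nu_indep : forall A B : {set 'I_n}, [disjoint A & B]%B ->
  box_independent nu A B).

Lemma integralM_depends_on (A B : {set 'I_n}) (f g : n.-tuple R -> R) :
  [disjoint A & B]%B -> depends_on A f -> depends_on B g ->
  nu.-integrable setT (fun x => (f x)%:E) ->
  nu.-integrable setT (fun x => (g x)%:E) ->
  nu.-integrable setT (fun x => (f x * g x)%:E) /\
  (\int[nu]_x (f x * g x)%:E = \int[nu]_x (f x)%:E * \int[nu]_x (g x)%:E)%E.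
Proof.
move=> AB fA gB fi gi.
pose V : {RV nu >-> n.-tuple R} := mfun_Sub (mem_set (@measurable_restr R n A)).
pose W : {RV nu >-> n.-tuple R} := mfun_Sub (mem_set (@measurable_restr R n B)).
have fE : (fun w => (f (V w))%:E) = (fun x => (f x)%:E).
  by apply/funext => x; rewrite /V /= fA.
have gE : (fun w => (g (W w))%:E) = (fun x => (g x)%:E).
  by apply/funext => x; rewrite /W /= gB.
have fgE : (fun w => (f (V w) * g (W w))%:E) = (fun x => (f x * g x)%:E).
  by apply/funext => x; rewrite /V /W /= fA gB.
have mf : measurable_fun setT f.
  by apply/measurable_EFinP; exact: measurable_int fi.
have mg : measurable_fun setT g.
  by apply/measurable_EFinP; exact: measurable_int gi.
have := @integralM_independent _ _ _ _ _ _ _ _ V W f g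
  (restr_independent AB (nu_indep AB)) mf mg.
by rewrite fE gE fgE; apply.
Qed.

Lemma integralM_box (A B : {set 'I_n}) (E : 'I_n -> set R)
    (f g : n.-tuple R -> R) :
  (forall i, measurable (E i)) ->
  [disjoint A & B]%B -> depends_on A f -> depends_on B g ->
  nu.-integrable setT (fun x => (f x)%:E) ->
  nu.-integrable setT (fun x => (g x)%:E) ->
  (\int[nu]_(x in box (A :|: B) E) (f x * g x)%:E =
   \int[nu]_(x in box A E) (f x)%:E * \int[nu]_(x in box B E) (g x)%:E)%E.
Proof.
move=> mE AB fA gB fi gi; rewrite (integral_indic_mul nu (box (A :|: B) E)).
rewrite (integral_indic_mul nu (box A E)) (integral_indic_mul nu (box B E)).
have mA := measurable_box A mE; have mB := measurable_box B mE.
have [_ <-] := integralM_depends_on AB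
  (depends_onM fA (depends_on_box A E)) (depends_onM gB (depends_on_box B E))
  (integrable_indic_mul mA fi) (integrable_indic_mul mB gi).
by apply: eq_integral => x _; rewrite boxU indicI /= mulrACA.
Qed.

(** The case of the constant 1 on the complement of [S]. It lets functions of (x_i)_{i in S} be
    compared on full boxes, which generate, although they are only known on boxes over [S]. *)
Lemma integral_boxT (S : {set 'I_n}) (E : 'I_n -> set R)
    (f : n.-tuple R -> R) :
  (forall i, measurable (E i)) -> depends_on S f ->
  nu.-integrable setT (fun x => (f x)%:E) ->
  (\int[nu]_(x in box [set: 'I_n]%SET E) (f x)%:E =
   \int[nu]_(x in box S E) (f x)%:E * nu (box (~: S)%SET E))%E.
Proof.
move=> mE fS fi; rewrite -(finset.setUCr S).
have i1 : nu.-integrable setT (fun x : n.-tuple R => ((fun=> 1%R) x)%:E).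
  exact: finite_measure_integrable_cst.
have dS : [disjoint S & ~: S]%B by rewrite -finset.setI_eq0 finset.setICr.
have := @integralM_box S (~: S)%SET E f (fun=> 1) mE dS fS (fun=> erefl) fi i1.
under eq_integral do rewrite mulr1.
by rewrite integral_cst ?mul1e//; exact: measurable_box.
Qed.

End independent_coordinates.

(** * Expansions over subsets *)

(* The density of the law of the subvector indexed by [S]. *)
Definition partial_density (R : realType) (n : nat)
    (h : {set 'I_n} -> n.-tuple R -> R) (S : {set 'I_n}) (x : n.-tuple R) : R :=
  \sum_(A : {set 'I_n} | A \subset S) h A x.

(** For disjoint [A] and [B], a subset of the union amounts to a pair of subsets, its two
    intersections. *)
Lemma partial_densityU (R : realType) (n : nat)
    (h : {set 'I_n} -> n.-tuple R -> R) (A B : {set 'I_n}) (x : n.-tuple R) :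
  [disjoint A & B]%B ->
  partial_density h (A :|: B) x =
  \sum_(p : {set 'I_n} * {set 'I_n} | (p.1 \subset A) && (p.2 \subset B))
    h (p.1 :|: p.2)%SET x.
Proof.
move=> AB; rewrite /partial_density.
rewrite (reindex_onto (fun p : {set 'I_n} * {set 'I_n} => p.1 :|: p.2)%SET
  (fun C => (C :&: A, C :&: B)%SET)) /=; last first.
  by move=> C CAB; rewrite -finset.setIUr; exact/finset.setIidPl.
apply: eq_bigl => -[C D] /=; apply/andP/andP.
  move=> [_ /eqP[<- <-]]; split; exact: finset.subsetIr.
move=> [CA DB]; split; first exact: finset.setUSS.
apply/eqP; congr (_, _); rewrite finset.setIUl.
  rewrite (finset.setIidPl CA)
    [X in (_ :|: X)%SET](_ : _ = finset.set0) ?finset.setU0//.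
  apply/eqP; rewrite finset.setI_eq0 disjoint_sym.
  exact: disjointWr DB AB.
rewrite (finset.setIidPl DB)
  [X in (X :|: _)%SET](_ : _ = finset.set0) ?finset.set0U//.
apply/eqP; rewrite finset.setI_eq0; exact: disjointWl CA AB.
Qed.

Lemma partial_densityM (R : realType) (n : nat)
    (h : {set 'I_n} -> n.-tuple R -> R) (A B : {set 'I_n}) (x : n.-tuple R) :
  partial_density h A x * partial_density h B x =
  \sum_(p : {set 'I_n} * {set 'I_n} | (p.1 \subset A) && (p.2 \subset B))
    h p.1 x * h p.2 x.
Proof.
rewrite /partial_density mulr_suml.
rewrite -(pair_big (fun C : {set 'I_n} => C \subset A)
  (fun D : {set 'I_n} => D \subset B) (fun C D => h C x * h D x)) /=.
by apply: eq_bigr => C _; rewrite mulr_sumr.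
Qed.

(** * Independence of blocks and factorization of terms *)

Section orthogonal_expansion.
Context (R : realType) (n : nat) (pi nu : probability (n.-tuple R) R).
Context (h : {set 'I_n} -> n.-tuple R -> R).
Context (nu_indep : forall A B : {set 'I_n}, [disjoint A & B]%B ->
  box_independent nu A B).
Context (h_int : forall A, nu.-integrable setT (fun x => (h A x)%:E)).
Context (h_dep : forall A, depends_on A (h A)).
Context (h_ortho : forall (A : {set 'I_n}) (i : 'I_n) (E : 'I_n -> set R),
  i \in A -> (forall i, measurable (E i)) ->
  (\int[nu]_(x in box (A :\ i)%SET E) (h A x)%:E = 0)%E).
Context (pi_density : forall E : 'I_n -> set R, (forall i, measurable (E i)) ->
  (pi (box [set: 'I_n]%SET E) =
   \int[nu]_(x in box [set: 'I_n]%SET E) (\sum_A h A x)%:E)%E).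

Local Notation f := (partial_density h).

Lemma partial_density_dep S : depends_on S (f S).
Proof.
move=> x; apply: eq_bigr => A AS.
exact: (depends_onS AS (@h_dep A)).
Qed.

Lemma partial_density_int S : nu.-integrable setT (fun x => (f S x)%:E).
Proof.
under eq_fun do rewrite -sumEFin.
by apply: integrable_sum => // A _; exact: h_int.
Qed.

(** The box over [S] is cut into boxes over [A :&: S] and [S :\: A]. The second involves no
    coordinate of [A] and factors out; the first avoids some [i] in [A], so orthogonality makes its
    integral vanish. *)
Lemma integral_box_eq0 (A S : {set 'I_n}) (E : 'I_n -> set R) :
  ~~ (A \subset S) -> (forall i, measurable (E i)) ->
  (\int[nu]_(x in box S E) (h A x)%:E = 0)%E.
Proof.
move=> /subsetPn[i iA iS] mE.
have AS : [disjoint A & S :\: A]%B.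
  by rewrite -finset.setI_eq0 finset.setIDA finset.setDIl finset.setDv
    finset.set0I.
have mE' j : measurable (if j \in S then E j else setT) by case: ifP.
have i1 : nu.-integrable setT
    (fun x => ((\1_(box (A :&: S) E) : n.-tuple R -> R) x)%:E).
  by apply: integrable_indic; exact: measurable_box.
have i2 : nu.-integrable setT
    (fun x => ((\1_(box (S :\: A) E) : n.-tuple R -> R) x)%:E).
  by apply: integrable_indic; exact: measurable_box.
have i3 : nu.-integrable setT
    (fun x => (h A x * (\1_(box (A :&: S) E) : n.-tuple R -> R) x)%:E).
  by apply: integrable_indic_mul => //; exact: measurable_box.
have d1 : depends_on A
    (fun x => h A x * (\1_(box (A :&: S) E) : n.-tuple R -> R) x).
  apply: depends_onM; first exact: h_dep.
  exact: (depends_onS (finset.subsetIl A S) (depends_on_box _ _ )).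
have [_] := integralM_depends_on nu_indep AS d1 (depends_on_box _ E) i3 i2.
rewrite -(integral_indic_mul nu (box (A :&: S) E)) (box_setI_setD1 E iA iS).
rewrite (h_ortho iA mE') mul0e => <-.
rewrite integral_indic_mul; apply: eq_integral => x _; congr (_%:E).
rewrite -mulrA; congr (_ * _).
have -> : (box S E : set (n.-tuple R)) = box (A :&: S) E `&` box (S :\: A) E.
  by rewrite -boxU finset.setIC finset.setID.
by rewrite indicI /= (box_setI_setD1 E iA iS).
Qed.

Lemma pi_box (S : {set 'I_n}) (E : 'I_n -> set R) :
  (forall i, measurable (E i)) ->
  (pi (box S E) = \int[nu]_(x in box S E) (f S x)%:E)%E.
Proof.
move=> mE; have mS : measurable (box S E) by exact: measurable_box.
have iS A : nu.-integrable (box S E) (fun x => (h A x)%:E).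
  by apply: integrableS (h_int A).
rewrite [in LHS]box_setT pi_density -?box_setT; last by move=> i; case: ifP.
under eq_integral do rewrite -sumEFin.
under [RHS]eq_integral do rewrite -sumEFin.
rewrite !integral_sum// [RHS]big_mkcond; apply: eq_bigr => A _.
by case: ifPn => // AS; rewrite integral_box_eq0.
Qed.

Lemma box_independent_of_factor (A B : {set 'I_n}) :
  [disjoint A & B]%B ->
  (forall C D : {set 'I_n}, C \subset A -> D \subset B ->
    {ae nu, forall x, h (C :|: D)%SET x = h C x * h D x}) ->
  box_independent pi A B.
Proof.
move=> AB hfac E mE; rewrite !pi_box// -integralM_box//; last 4 first.
- exact: partial_density_dep.
- exact: partial_density_dep.
- exact: partial_density_int.
- exact: partial_density_int.
have [fgi _] := integralM_depends_on nu_indep AB (@partial_density_dep A)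
  (@partial_density_dep B) (partial_density_int A) (partial_density_int B).
apply: ae_eq_integral.
- exact: measurable_box.
- by apply: measurable_funTS; exact: measurable_int (partial_density_int _).
- by apply: measurable_funTS; exact: measurable_int fgi.
(* There are finitely many pairs, so one null set serves them all. *)
have : {ae nu, forall x, forall p : {set 'I_n} * {set 'I_n},
    (p.1 \subset A) && (p.2 \subset B) ->
    h (p.1 :|: p.2)%SET x = h p.1 x * h p.2 x}.
  apply: filter_forall => -[C D] /=.
  have [/andP[CA DB]|_] := boolP (_ && _); last exact: aeW.
  by apply: filterS (hfac C D CA DB) => x.
apply: filterS => x hx _; congr (_%:E).
by rewrite partial_densityU// partial_densityM; apply: eq_bigr.
Qed.

(** Independence gives equal integrals on boxes over [A :|: B]. Both functions depend on these
    coordinates only, so on a full box the remaining sides contribute the same factor to each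
    integral. *)
Lemma partial_density_factor (A B : {set 'I_n}) :
  [disjoint A & B]%B -> box_independent pi A B ->
  {ae nu, forall x, f (A :|: B)%SET x = f A x * f B x}.
Proof.
move=> AB piAB.
have fd := @partial_density_dep.
have [fgi _] := integralM_depends_on nu_indep AB (fd A) (fd B)
  (partial_density_int A) (partial_density_int B).
have fgd : depends_on (A :|: B) (fun x => f A x * f B x).
  apply: depends_onM.
    exact: depends_onS (finset.subsetUl A B) (fd A).
  exact: depends_onS (finset.subsetUr A B) (fd B).
have eqbox E : (forall i, measurable (E i)) ->
    (\int[nu]_(x in box [set: 'I_n]%SET E) (f (A :|: B)%SET x)%:E =
     \int[nu]_(x in box [set: 'I_n]%SET E) (f A x * f B x)%:E)%E.
  move=> mE; rewrite (integral_boxT nu_indep mE (fd _) (partial_density_int _)).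
  rewrite (integral_boxT nu_indep mE fgd fgi); congr (_ * _)%E.
  rewrite -pi_box// piAB// !pi_box// integralM_box//;
    exact: partial_density_int.
have : ae_eq nu setT (fun x => (f (A :|: B)%SET x)%:E)
    (fun x => (f A x * f B x)%:E).
  apply: integral_ae_eq => //.
  - exact: partial_density_int.
  - exact: measurable_int fgi.
  move=> E _ mE; apply: (@eq_integral_preimage _ _ _ _ _ _ _ nu nu id id
    _ _ (@boxes R n)) => //.
  - exact: partial_density_int.
  - exact: boxes_setI.
  - exact: measurable_boxes_gen.
  - have := eqbox (fun=> setT) (fun=> measurableT).
    by rewrite (_ : box _ _ = setT)//; apply/seteqP; split.
  - by move=> _ [F mF ->]; exact: eqbox.
by apply: filterS => x /(_ I)[].
Qed.

(** Independence is assumed for all pairs of subsets because the induction, on the total size of the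
    pair, needs the factorization at every smaller pair. Pairs with an empty member are covered as
    well. *)
Lemma factor_of_box_independent (A B : {set 'I_n}) :
  [disjoint A & B]%B ->
  (forall C D : {set 'I_n}, C \subset A -> D \subset B ->
    box_independent pi C D) ->
  {ae nu, forall x, h (A :|: B)%SET x = h A x * h B x}.
Proof.
have [k] := ubnP (#|A| + #|B|)%N; elim: k A B => // k IH A B kAB AB piAB.
have : {ae nu, forall x, forall p : {set 'I_n} * {set 'I_n},
    (p.1 \subset A) && (p.2 \subset B) && (p != (A, B)) ->
    h (p.1 :|: p.2)%SET x = h p.1 x * h p.2 x}.
  apply: filter_forall => -[C D] /=.
  have [/andP[/andP[CA DB] CD]|_] := boolP (_ && _); last exact: aeW.
  suff : {ae nu, forall x, h (C :|: D)%SET x = h C x * h D x}.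
    by apply: filterS => x.
  apply: IH.
  - rewrite ltnS in kAB; apply: leq_trans kAB.
    (* If the total size did not drop, both inclusions would be equalities. *)
    rewrite ltnNge; move: CD; apply: contra => cAB.
    have cC := subset_leq_card CA; have cD := subset_leq_card DB.
    have eA : C = A by apply/eqP; rewrite finset.eqEcard CA /=
      -(leq_add2r #|B|) (leq_trans cAB)// leq_add2l.
    have eB : D = B by apply/eqP; rewrite finset.eqEcard DB /=
      -(leq_add2l #|A|) (leq_trans cAB)// leq_add2r.
    by rewrite eA eB eqxx.
  - exact: disjointWl CA (disjointWr DB AB).
  - move=> C' D' C'C D'D; apply: piAB.
      exact: fintype.subset_trans CA.
    exact: fintype.subset_trans DB.
have := partial_density_factor AB
  (piAB A B (fintype.subxx _) (fintype.subxx _)).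
apply: filterS2 => x; rewrite partial_densityU// partial_densityM => fx hx.
move: fx; rewrite (bigD1 (A, B)) /= ?subxx// [in RHS](bigD1 (A, B)) /= ?subxx//.
by rewrite (eq_bigr _ hx) => /addIr.
Qed.

End orthogonal_expansion.

(** * Subvectors, joint laws and almost sure statements *)

Lemma measurable_subvec (R : realType) (n : nat) (A : {set 'I_n}) :
  measurable_fun setT (@subvec R n A).
Proof.
apply/measurable_fun_tnthP => i; rewrite (_ : _ \o _ =
    fun x => tnth x (enum_val i)); first exact: measurable_tnth.
by apply/funext => x; rewrite /= tnth_mktuple.
Qed.

Lemma subvec_restr (R : realType) (n : nat) (A B : {set 'I_n})
    (x : n.-tuple R) :
  A \subset B -> subvec A (restr B x) = subvec A x.
Proof.
move=> AB; apply: eq_from_tnth => i; rewrite !tnth_mktuple.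
by rewrite (fintype.subsetP AB)// enum_valP.
Qed.

Definition subbox (R : realType) (n : nat) (A : {set 'I_n})
    (E : 'I_n -> set R) : set (#|A|.-tuple R) :=
  box [set: 'I_(#|A|)]%SET (fun k => E (enum_val k)).

Arguments subbox {R n} A E.

Lemma preimage_subbox (R : realType) (n : nat) (A : {set 'I_n})
    (E : 'I_n -> set R) :
  @subvec R n A @^-1` subbox A E = box A E.
Proof.
apply/seteqP; split => x h i iA.
  have := h (enum_rank_in iA i) (finset.in_setT _).
  by rewrite tnth_mktuple enum_rankK_in.
by rewrite tnth_mktuple; apply: h; exact: enum_valP.
Qed.

Lemma measurable_random_vector (R : realType) (d : measure_display)
    (T : measurableType d) (P : probability T R) (n : nat)
    (X : 'I_n -> {RV P >-> R}) :
  measurable_fun setT (random_vector X).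
Proof.
apply/measurable_fun_tnthP => i; rewrite (_ : _ \o _ = X i)//.
by apply/funext => w; rewrite /= tnth_mktuple.
Qed.

Definition joint_rv (R : realType) (d : measure_display)
    (T : measurableType d) (P : probability T R) (n : nat)
    (X : 'I_n -> {RV P >-> R}) : {RV P >-> n.-tuple R} :=
  mfun_Sub (mem_set (measurable_random_vector X)).

Definition joint_law (R : realType) (d : measure_display)
    (T : measurableType d) (P : probability T R) (n : nat)
    (X : 'I_n -> {RV P >-> R}) : probability (n.-tuple R) R :=
  distribution P (joint_rv X).

(** Measurability of [Q] reduces negligibility to measure zero of the exceptional set itself; a null
    set of [T] covering its preimage need not be a preimage. *)
Lemma ae_distribution (R : realType) (d d' : measure_display)
    (T : measurableType d) (T' : measurableType d') (P : probability T R)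
    (V : {RV P >-> T'}) (Q : T' -> Prop) :
  measurable [set x | Q x] ->
  {ae P, forall w, Q (V w)} <-> {ae distribution P V, forall x, Q x}.
Proof.
move=> mQ; have mQC : measurable (~` [set x | Q x]) by exact: measurableC.
have mVQ : measurable (~` [set w | Q (V w)]).
  apply: measurableC; rewrite -[X in measurable X]setTI.
  exact: (measurable_funPT V).
split.
  by move/(negligibleP _ mVQ) => h; apply/(negligibleP _ mQC).
by move/(negligibleP _ mQC) => h; apply/(negligibleP _ mVQ).
Qed.

Lemma measurable_eq_fun (R : realType) (d : measure_display)
    (T : measurableType d) (f g : T -> R) :
  measurable_fun setT f -> measurable_fun setT g ->
  measurable [set x | f x = g x].
Proof.
move=> mf mg; have -> : [set x | f x = g x] = (f \- g) @^-1` [set 0].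
  apply/seteqP; split => x /= => [->|/eqP]; first by rewrite subrr.
  by rewrite subr_eq0 => /eqP.
by rewrite -[X in measurable X]setTI; apply: measurable_funB.
Qed.

(** Measures are written as integrals of the constant 1, so that [eq_integral_preimage] applies with
    identity maps and left rays as generators. *)
Lemma eq_cdf_distribution (R : realType) (d d' : measure_display)
    (T : measurableType d) (T' : measurableType d') (P : probability T R)
    (P' : probability T' R) (X : {RV P >-> R}) (Y : {RV P' >-> R}) :
  (forall x, cdf Y x = cdf X x) ->
  forall E, measurable E -> distribution P' Y E = distribution P X E.
Proof.
move=> YX E mE.
have law d'' (S : measurableType d'') (Q : probability S R)
      (Z : {RV Q >-> R}) F :
    measurable F ->
    (\int[distribution Q Z]_(x in F) (cst 1%E) x = distribution Q Z F)%E.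
  by move=> mF; rewrite integral_cst// mul1e.
rewrite -!law// -[E in LHS]preimage_id -[E in RHS]preimage_id.
apply: (@eq_integral_preimage _ _ _ _ _ _ _ _ _ id id _ _
  [set B : set R | exists a, B = `]-oo, a]%classic]) => //.
- exact: finite_measure_integrable_cst.
- exact: finite_measure_integrable_cst.
- move=> _ _ [a ->] [b ->]; exists (Num.min a b); apply/seteqP; split => x /=;
  by rewrite !in_itv /= le_min => /andP.
- exact: measurable_itvNyc_gen.
- by rewrite !law// !probability_setT.
- by move=> _ [a ->]; rewrite !preimage_id !law//; exact: YX.
Qed.

(** * The expansion given by the canonical functions *)

Section canonical.
Context (R : realType) (n : nat) (d : measure_display) (T : measurableType d)
  (P : probability T R) (X : 'I_n -> {RV P >-> R})
  (d' : measure_display) (T' : measurableType d') (P' : probability T' R)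
  (xi : 'I_n -> {RV P' >-> R}) (hxi : mutually_independent xi)
  (hcdf : forall (i : 'I_n) (x : R), cdf (xi i) x = cdf (X i) x)
  (g : forall A : {set 'I_n}, #|A|.-tuple R -> R)
  (hg : canonical_functions X xi g).

(* With the value 1 at the empty set, 1 + U_n is the sum of all the terms. *)
Definition expansion_term (A : {set 'I_n}) (x : n.-tuple R) : R :=
  if A == finset.set0 then 1 else zero_on_singletons g (subvec A x).
Local Notation h := expansion_term.
Local Notation nu := (joint_law xi).
Local Notation pi := (joint_law X).

Lemma expansion_term0 x : h finset.set0 x = 1.
Proof. by rewrite /h eqxx. Qed.

Lemma expansion_term1 (A : {set 'I_n}) x : #|A| = 1%N -> h A x = 0.
Proof.
move=> A1; have e : (#|A| == 1%N) by apply/eqP.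
rewrite /h /zero_on_singletons e.
by case: eqP A1 => // ->; rewrite finset.cards0.
Qed.

Lemma expansion_term2 (A : {set 'I_n}) x :
  (2 <= #|A|)%N -> h A x = g (subvec A x).
Proof.
move=> A2; rewrite /h /zero_on_singletons (gtn_eqF A2).
by case: eqP A2 => // ->; rewrite finset.cards0.
Qed.

Lemma card_set_cases (A : {set 'I_n}) :
  [\/ A = finset.set0, #|A| = 1%N | (2 <= #|A|)%N].
Proof.
case E : #|A| => [|[|k]]; [|by apply: Or32|by apply: Or33].
by apply: Or31; apply/eqP; rewrite -finset.cards_eq0 E.
Qed.

Lemma expansion_term_dep A : depends_on A (h A).
Proof. by move=> x; rewrite /h subvec_restr. Qed.

Lemma measurable_expansion_term A : measurable_fun setT (h A).
Proof.
have [->|A1|A2] := card_set_cases A.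
- by rewrite (_ : h _ = cst 1) //; apply/funext => x; rewrite expansion_term0.
- by rewrite (_ : h _ = cst 0) //; apply/funext => x; rewrite expansion_term1.
rewrite (_ : h A = @g A \o @subvec R n A); last first.
  by apply/funext => x; rewrite expansion_term2.
apply: measurableT_comp; first exact: canonical_borel hg A A2.
exact: measurable_subvec.
Qed.

Lemma expansion_term_comp_int A :
  P'.-integrable setT (fun w => (h A (random_vector xi w))%:E).
Proof.
have [->|A1|A2] := card_set_cases A.
- under eq_fun do rewrite expansion_term0.
  exact: finite_measure_integrable_cst.
- under eq_fun do rewrite expansion_term1//.
  exact: finite_measure_integrable_cst.
apply/integrableP; split.
  apply/measurable_EFinP; apply: measurableT_comp.
    exact: measurable_expansion_term.
  exact: measurable_random_vector.
have := canonical_A1 hg A2; rewrite unlock; apply: le_lt_trans.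
rewrite le_eqVlt; apply/orP; left; apply/eqP; apply: eq_integral => x _.
by rewrite /= expansion_term2.
Qed.

Lemma expansion_term_int A : nu.-integrable setT (fun x => (h A x)%:E).
Proof.
apply: integrable_pushforward => //; last exact: expansion_term_comp_int.
by apply/measurable_EFinP; exact: measurable_expansion_term.
Qed.

(** This is (A2) tested on one event: the box over [A :\ i] pulls back into the sigma-algebra of the
    conditioning subvector, where the conditional expectation 0 has integral 0. *)
Lemma expansion_term_ortho (A : {set 'I_n}) (i : 'I_n) (E : 'I_n -> set R) :
  i \in A -> (forall i, measurable (E i)) ->
  (\int[nu]_(x in box (A :\ i)%SET E) (h A x)%:E = 0)%E.
Proof.
move=> iA mE; have [A0|A1|A2] := card_set_cases A.
- by move: iA; rewrite A0 finset.inE.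
- by apply: integral0_eq => x _; rewrite expansion_term1.
have mh := measurable_expansion_term A.
have mB := measurable_box (A :\ i)%SET mE.
rewrite integral_pushforward//; last 2 first.
- exact/measurable_EFinP.
- apply: integrableS (expansion_term_comp_int A) => //.
  by rewrite -[X in measurable X]setTI; exact: (measurable_funPT (joint_rv xi)).
have [_ _ /(_ (joint_rv xi @^-1` box (A :\ i)%SET E))] := canonical_A2 hg A2 iA.
rewrite integral0 => h0; rewrite [RHS]h0; last first.
  exists (subbox (A :\ i)%SET E); first by apply: measurable_box => k.
  by rewrite setTI -preimage_subbox.
by apply: eq_integral => w _; rewrite /= expansion_term2.
Qed.

Lemma joint_law_box (S : {set 'I_n}) (E : 'I_n -> set R) :
  (forall i, measurable (E i)) ->
  (nu (box S E) = \prod_(i in S) distribution P' (xi i) (E i))%E.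
Proof.
move=> mE; rewrite -hxi//; congr (P' _); apply/seteqP; split => w hw i iS.
  by have := hw i iS; rewrite tnth_mktuple.
by rewrite tnth_mktuple; exact: hw.
Qed.

Lemma joint_law_box_independent (A B : {set 'I_n}) :
  [disjoint A & B]%B -> box_independent nu A B.
Proof.
move=> AB E mE; rewrite !joint_law_box//.
rewrite -bigU//=; apply: eq_bigl => i; by rewrite !finset.inE.
Qed.

Lemma sum_expansion_term x : \sum_(A : {set 'I_n}) h A x = 1 + U_stat g x.
Proof.
rewrite (bigD1 finset.set0)//= expansion_term0; congr (_ + _).
rewrite /U_stat big_mkcond [RHS]big_mkcond; apply: eq_bigr => A _.
have [->|A1|A2] := card_set_cases A.
- by rewrite eqxx finset.cards0.
- by rewrite expansion_term1// A1 /=; case: ifP.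
- by rewrite A2 expansion_term2//; case: eqP A2 => // ->; rewrite finset.cards0.
Qed.

Lemma joint_law_density E : measurable E ->
  (pi E = \int[nu]_(x in E) (\sum_(A : {set 'I_n}) h A x)%:E)%E.
Proof.
move=> mE.
have si : nu.-integrable setT (fun x => (\sum_(A : {set 'I_n}) h A x)%:E).
  under eq_fun do rewrite -sumEFin.
  by apply: integrable_sum => // A _; exact: expansion_term_int.
have cstE F : measurable F -> (\int[pi]_(x in F) (cst 1%E) x = pi F)%E.
  by move=> mF; rewrite integral_cst// mul1e.
rewrite -cstE// -[E in LHS]preimage_id -[E in RHS]preimage_id.
apply: (@eq_integral_preimage _ _ _ _ _ _ _ _ _ id id _ _
  (@orthants R n)) => //.
- exact: finite_measure_integrable_cst.
- exact: orthants_setI.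
- exact: measurable_orthants_gen.
(* The whole space need not be an orthant, so the total mass is computed directly: by orthogonality
   only the empty set contributes, with the value 1. *)
- rewrite cstE// probability_setT; under eq_integral do rewrite -sumEFin.
  rewrite integral_sum//; last by move=> A; exact: expansion_term_int.
  rewrite (bigD1 finset.set0)//= [X in (_ + X)%E]big1 ?adde0.
    under eq_integral do rewrite expansion_term0.
    by rewrite integral_cst// mul1e; exact/esym/probability_setT.
  move=> A /finset.set0Pn[i iA].
  have := expansion_term_ortho iA (fun=> measurableT).
  by rewrite (_ : box _ _ = setT)//; apply/seteqP; split.
move=> _ [x ->]; rewrite !preimage_id cstE; last exact: measurable_orthant.
have -> : pi (orthant x) = joint_cdf X x.
  rewrite /joint_cdf; congr (P _); apply/seteqP; split => w hw i;
  by have := hw i; rewrite tnth_mktuple.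
have sE : (fun x => (\sum_(A : {set 'I_n}) h A x)%:E) =
    (fun t => (1 + U_stat g t)%:E).
  by apply/funext => y; rewrite sum_expansion_term.
rewrite (canonical_repr hg) (@iterated_integralE _ _ _ nu); last by rewrite -sE.
  by rewrite sE.
(* The iterated integral is taken against the marginals of [X], while [nu] comes from [xi]; equality
   of the cdf's identifies the laws. *)
move=> F mF; rewrite joint_law_box//; apply: eq_big => [i|i _].
  by rewrite finset.inE.
exact: eq_cdf_distribution.
Qed.

End canonical.

(** * From m-dependence to boxes *)

Lemma gap_at_leastS (n m : nat) (A B C D : {set 'I_n}) :
  C \subset A -> D \subset B -> gap_at_least m A B -> gap_at_least m C D.
Proof.
move=> CA DB AB i j iC jD.
by apply: AB; [exact: (fintype.subsetP CA)|exact: (fintype.subsetP DB)].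
Qed.

Lemma gap_at_least_disjoint (n m : nat) (A B : {set 'I_n}) :
  (1 <= m)%N -> gap_at_least m A B -> [disjoint A & B]%B.
Proof.
move=> m1 AB; apply/fintype.pred0P => i /=; apply/negbTE/negP => /andP[iA iB].
have := AB i i iA iB; rewrite leqNgt => /negP; apply.
by rewrite -[X in (X < _)%N]addn0 ltn_add2l.
Qed.

(** The right-hand side also admits empty blocks, whose box is the whole space; the sums over all
    pairs of subsets contain them. Conversely, a subvector is a function of the restricted vector,
    so independence of restrictions is enough. *)
Lemma m_dependent_box (R : realType) (n m : nat) (d : measure_display)
    (T : measurableType d) (P : probability T R) (X : 'I_n -> {RV P >-> R}) :
  (1 <= m)%N ->
  m_dependent m X <->
  (forall A B : {set 'I_n}, gap_at_least m A B ->
    box_independent (joint_law X) A B).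
Proof.
move=> m1; split => [dep A B AB E mE|ind A B _ _ AB E F mE mF].
  have [->|A0] := eqVneq A finset.set0.
    by rewrite finset.set0U box0 probability_setT mul1e.
  have [->|B0] := eqVneq B finset.set0.
    by rewrite finset.setU0 box0 probability_setT mule1.
  have msub (C : {set 'I_n}) : measurable (subbox C E).
    by apply: measurable_box => k; exact: mE.
  have := dep A B A0 B0 AB _ _ (msub A) (msub B).
  by rewrite boxU -!preimage_subbox.
have AB0 := gap_at_least_disjoint m1 AB.
have msub (C : {set 'I_n}) (G : set (#|C|.-tuple R)) : measurable G ->
    measurable (@subvec R n C @^-1` G).
  by move=> mG; rewrite -[X in measurable X]setTI; exact: measurable_subvec.
have := restr_independent AB0 (ind A B AB) (msub A E mE) (msub B F mF).
have pre (C : {set 'I_n}) (G : set (#|C|.-tuple R)) :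
    restr C @^-1` (@subvec R n C @^-1` G) = @subvec R n C @^-1` G.
  by apply/seteqP; split => x /=; rewrite subvec_restr.
by rewrite !pre.
Qed.

Theorem theorem5p6 (R : realType) (n m : nat)
    (hn : (2 <= n)%N) (hm : (1 <= m <= n)%N)
    (d : measure_display) (T : measurableType d) (P : probability T R)
    (X : 'I_n -> {RV P >-> R})
    (hX : joint_cdf_abs_continuous X)
    (d' : measure_display) (T' : measurableType d') (P' : probability T' R)
    (xi : 'I_n -> {RV P' >-> R})
    (hxi_indep : mutually_independent xi)
    (hxi_cdf : forall (i : 'I_n) (x : R), cdf (xi i) x = cdf (X i) x)
    (g : forall A : {set 'I_n}, #|A|.-tuple R -> R)
    (hg : canonical_functions X xi g) :
  m_dependent m X <->
  (forall A B : {set 'I_n}, A != finset.set0 -> B != finset.set0 ->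
     gap_at_least m A B ->
     {ae P', forall w,
        zero_on_singletons g (subvec (A :|: B)%SET (random_vector xi w)) =
        zero_on_singletons g (subvec A (random_vector xi w)) *
        zero_on_singletons g (subvec B (random_vector xi w))}).

Proof.
have m1 : (1 <= m)%N by case/andP: hm.
have disj := @gap_at_least_disjoint n m _ _ m1.
have nuI := @joint_law_box_independent _ _ _ _ _ _ hxi_indep.
have hint := expansion_term_int hg.
have hdep := @expansion_term_dep R n g.
have hortho := @expansion_term_ortho _ _ _ _ _ _ _ _ _ _ _ hg.
have piE E (mE : forall i, measurable (E i)) :=
  joint_law_density hxi_indep hxi_cdf hg (measurable_box [set: 'I_n]%SET mE).
(* On nonempty sets [expansion_term] is [zero_on_singletons g] of the subvector, so only the passage
   from [P'] to the law of [xi] is at stake. *)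
have factorE A B : A != finset.set0 -> B != finset.set0 ->
    {ae P', forall w,
        zero_on_singletons g (subvec (A :|: B)%SET (random_vector xi w)) =
        zero_on_singletons g (subvec A (random_vector xi w)) *
        zero_on_singletons g (subvec B (random_vector xi w))} <->
    {ae joint_law xi, forall x, expansion_term g (A :|: B)%SET x =
       expansion_term g A x * expansion_term g B x}.
  move=> A0 B0; rewrite -(ae_distribution (joint_rv xi)); last first.
    have mh := measurable_expansion_term hg.
    apply: measurable_eq_fun; first exact: mh.
    by apply: measurable_funM; exact: mh.
  rewrite /expansion_term finset.setU_eq0 (negbTE A0) (negbTE B0).
  by [].
rewrite m_dependent_box//; split => [ind A B A0 B0 AB|fac A B AB].
  apply/factorE => //.
  apply: (factor_of_box_independent nuI hint hdep hortho piE (disj _ _ AB)).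
  by move=> C D CA DB; apply: ind; exact: gap_at_leastS AB.
apply: (box_independent_of_factor nuI hint hdep hortho piE (disj _ _ AB)).
move=> C D CA DB.
(* The factorization hypothesis is silent on empty blocks; there the value 1 at the empty set gives
   the identity. *)
have [->|C0] := eqVneq C finset.set0.
  by apply: aeW => x; rewrite finset.set0U expansion_term0 mul1r.
have [->|D0] := eqVneq D finset.set0.
  by apply: aeW => x; rewrite finset.setU0 expansion_term0 mulr1.
by apply/factorE => //; apply: fac => //; exact: gap_at_leastS AB.
Qed.
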